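(* Let $p$ be an odd prime, $n$ a positive integer, and let $g,g'\in\mathbb{F}_{p^n}[x]$ be two extended-affine equivalent Dembowski-Ostrom polynomials. Then $\mathrm{rcf}(\mathrm{Quot}(\mathcal{D}_g))=\mathrm{rcf}(\mathrm{Quot}(\mathcal{D}_{g'}))$, where $\mathrm{rcf}(\mathrm{Quot}(\mathcal{D}_g))$ denotes the set $\{(\mathrm{rcf}(X),\mathrm{mult}_{\mathrm{rcf}(X)})\mid X\in\mathrm{Quot}(\mathcal{D}_g)\}$.
   Context: A Dembowski-Ostrom (DO) polynomial in $\mathbb{F}_{p^n}[x]$ is one of the form $\sum_{0\le i\le j\le n-1}u_{i,j}x^{p^i+p^j}$ with $u_{i,j}\in\mathbb{F}_{p^n}$. A linearized polynomial is one of the form $\sum_i u_ix^{p^i}$, $u_i\in\mathbb{F}_{p^n}$; it is a linearized permutation polynomial if its evaluation map on $\mathbb{F}_{p^n}$ is bijective. Fix an $\mathbb{F}_p$-basis of $\mathbb{F}_{p^n}$, so that each linearized polynomial is associated with the $n\times n$ matrix over $\mathbb{F}_p$ of the $\mathbb{F}_p$-linear map it induces. For a DO polynomial $g$ and $\alpha\in\mathbb{F}_{p^n}$, $\Delta_{g,\alpha}(x)=g(x+\alpha)-g(x)-g(\alpha)$ is a linearized polynomial; $M_{g,\alpha}$ denotes its associated matrix, and $\mathcal{D}_g=\{M_{g,\alpha}\mid\alpha\in\mathbb{F}_{p^n}\}$. The set of quotients is $\mathrm{Quot}(\mathcal{D}_g)=\{XY^{-1}\mid X,Y\in\mathcal{D}_g,\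 Y\text{ invertible}\}$ (a set of matrices, possibly empty). Two polynomials $g,g'\in\mathbb{F}_{p^n}[x]/(x^{p^n}-x)$ are extended-affine equivalent if there exist linearized permutation polynomials $L,L'$, a linearized polynomial $L''$, and $u,v,w\in\mathbb{F}_{p^n}$ with $g'(x)=L'(g(L(x)+u))+v+L''(x)+w \bmod (x^{p^n}-x)$. $\mathrm{rcf}(X)$ is the rational canonical form (Frobenius normal form) of a matrix $X$ over $\mathbb{F}_p$, and, for $X \in \mathrm{Quot}(\mathcal{D}_g)$, $\mathrm{mult}_{\mathrm{rcf}(X)}$ is the number of elements of the set $\mathrm{Quot}(\mathcal{D}_g)$ having the same rational canonical form as $X$ (and analogously for $g'$). *)

(* Defs.v *)
From HB Require Import structures.
From mathcomp Require Import all_boot all_order all_fingroup all_algebra all_field.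
From mathcomp Require Import boolp classical_sets.

Set Implicit Arguments.
Unset Strict Implicit.
Unset Printing Implicit Defensive.

Import GRing.Theory.
Local Open Scope ring_scope.

(* The field with p^n elements is an extension F of 'F_p of degree n; elements
   of F[x]/(x^(p^n) - x) are represented by polynomials over F, compared
   modulo 'X^(p^n) - 'X. *)

Definition DO_poly (p n : nat) (F : fieldExtType 'F_p) (g : {poly F}) : Prop :=
  exists u : 'I_n -> 'I_n -> F,
    g = \sum_(i < n) \sum_(j < n | (i <= j)%N) u i j *: 'X^(p ^ i + p ^ j).

Definition linearized (p : nat) (F : fieldExtType 'F_p) (L : {poly F}) : Prop :=
  exists (m : nat) (u : 'I_m -> F), L = \sum_(i < m) u i *: 'X^(p ^ i).

Definition linearized_perm (p : nat) (F : fieldExtType 'F_p) (L : {poly F}) :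
    Prop :=
  linearized L /\ bijective (fun x : F => L.[x]).

Definition EA_equiv (p n : nat) (F : fieldExtType 'F_p) (g g' : {poly F}) :
    Prop :=
  exists (L L' L'' : {poly F}) (u v w : F),
    [/\ linearized_perm L, linearized_perm L', linearized L''
      & g' %% ('X^(p ^ n) - 'X)
        = (L' \Po (g \Po (L + u%:P)) + v%:P + L'' + w%:P)
            %% ('X^(p ^ n) - 'X)].

Definition Delta (R : nzRingType) (g : {poly R}) (a : R) : {poly R} :=
  g \Po ('X + a%:P) - g - (g.[a])%:P.

(* Column j holds the coordinates of the image of the j-th basis vector
   (matrices act on column vectors), so that composition of maps corresponds to
   *m in the same order; mxof follows the opposite, row-vector convention. *)
Definition lin_matrix (p n : nat) (F : fieldExtType 'F_p) (b : n.-tuple F)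
    (L : {poly F}) : 'M['F_p]_n :=
  \matrix_(i < n, j < n) coord b i L.[b`_j].

(* finvect_type F is F itself, with its finType structure. *)
Definition D_set (p n : nat) (F : fieldExtType 'F_p) (b : n.-tuple F)
    (g : {poly F}) : {set 'M['F_p]_n} :=
  [set lin_matrix b (Delta g (a : F)) | a : finvect_type F].

Definition Quot (K : finFieldType) (n : nat) (D : {set 'M[K]_n}) :
    {set 'M[K]_n} :=
  [set X *m invmx Y | X in D, Y in D & Y \in unitmx].

(* Block-diagonal, with blocks the companion matrices of nonconstant monic
   polynomials each dividing the next; the cast identifies the sum of the block
   sizes (size s`_k).-1 with n. *)
Definition frobenius_form (K : fieldType) (n : nat) (C : 'M[K]_n) : Prop :=
  exists (s : seq {poly K})
         (e : (\sum_(k < size s) (size (s`_k)%R).-1)%N = n),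
    [/\ all (fun q : {poly K} => q \is monic) s,
        all (fun q : {poly K} => (1 < size q)%N) s,
        sorted (@dvdp K) s
      & C = castmx (e, e) (\mxdiag_(k < size s) companionmx s`_k)].

(* The matrix in Frobenius form similar to X. It exists and is unique for every
   X over a field (cyclic decomposition theorem), so the default value 0 is
   never used. *)
Definition rcf (K : finFieldType) (n : nat) (X : 'M[K]_n) : 'M[K]_n :=
  odflt 0 [pick C : 'M[K]_n |
            `[< frobenius_form C /\ similar_in unitmx X C >]].

Definition rcf_mult (K : finFieldType) (n : nat) (Q : {set 'M[K]_n})
    (X : 'M[K]_n) : nat :=
  #|[set Y in Q | rcf Y == rcf X]|.

Definition rcf_set (K : finFieldType) (n : nat) (Q : {set 'M[K]_n}) :
    set ('M[K]_n * nat) :=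
  [set (rcf X, rcf_mult Q X) | X in [set` Q]]%classic.

(* Main.v *)
(* Up to affine terms, passing from g to g' turns the polar form B(x, a) of g into
   L'(B(L x, L a)).  Hence D_g' = P D_g Q with P and Q the (invertible) matrices
   of L' and L, the factor Q cancels in quotients, Quot(D_g') = P Quot(D_g) P^-1,
   and conjugation preserves rational canonical forms with multiplicities. *)
Require Import Defs.
From HB Require Import structures.
From mathcomp Require Import all_boot all_order all_fingroup all_algebra all_field.
From mathcomp Require Import boolp classical_sets.
From mathcomp Require Import ring.

Set Implicit Arguments.
Unset Strict Implicit.
Unset Printing Implicit Defensive.

Import GRing.Theory.
Local Open Scope ring_scope.

Lemma invmx_mulmx (R : comUnitRingType) (n : nat) (A B : 'M[R]_n) :
  A \in unitmx -> B \in unitmx -> invmx (A *m B) = invmx B *m invmx A.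
Proof.
move=> uA uB; have uAB : A *m B \in unitmx by rewrite unitmx_mul uA.
by rewrite -[RHS](mulKmx uAB) -mulmxA (mulmxA B) mulmxV // mul1mx mulmxV // mulmx1.
Qed.

Lemma morphD0 (U V : zmodType) (f : U -> V) : {morph f : x y / x + y} -> f 0 = 0.
Proof. by move=> fD; apply: (@addrI _ (f 0)); rewrite -fD !addr0. Qed.

Section RationalCanonicalForm.

Variables (K : finFieldType) (n : nat).
Implicit Types (P Q X Y C : 'M[K]_n) (D : {set 'M[K]_n}).

Lemma similar_in_conj P X C : P \in unitmx ->
  similar_in unitmx X C -> similar_in unitmx (conjmx P X) C.
Proof.
move=> uP [V uV /eqP VX]; exists (V *m invmx P).
  by rewrite unitmx_mul uV unitmx_inv.
apply/eqP; rewrite -VX !conjumx ?unitmx_mul ?uV ?unitmx_inv //.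
by rewrite invmx_mulmx ?unitmx_inv // invmxK !mulmxA !mulmxKV.
Qed.

(* rcf picks from a predicate depending only on the similarity class, so the
   cyclic decomposition theorem is not needed. *)
Lemma rcf_conj P X : P \in unitmx -> rcf (conjmx P X) = rcf X.
Proof.
move=> uP; rewrite /rcf; congr odflt; apply: eq_pick => C /=.
apply: asbool_equiv_eq; split=> -[fC sC]; split=> //; last exact: similar_in_conj.
by rewrite -[X](conjmxK _ uP); apply: similar_in_conj; rewrite ?unitmx_inv.
Qed.

Lemma conjmx_inj P : P \in unitmx -> injective (fun X => conjmx P X).
Proof. by move=> uP; apply: can_inj (fun X => conjmxK X uP). Qed.

(** Conjugation by [P] is injective and preserves [rcf], so it carries the elements of [D] sharing
    the form of [X] bijectively onto those of the conjugate set sharing the form of [conjmx P X]. *)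
Lemma rcf_set_conj P D : P \in unitmx ->
  rcf_set [set conjmx P X | X in D] = rcf_set D.
Proof.
move=> uP; have mult X : rcf_mult [set conjmx P Y | Y in D] (conjmx P X) = rcf_mult D X.
  rewrite /rcf_mult -[RHS](card_imset _ (conjmx_inj uP)); apply: eq_card => Z.
  rewrite inE; apply/andP/imsetP => [[/imsetP[Y YD ->]]|[Y]].
    by rewrite !rcf_conj // => e; exists Y; rewrite // inE YD.
  by rewrite !inE => /andP[YD e] ->; rewrite !rcf_conj // imset_f.
rewrite /rcf_set; apply/seteqP; split=> _ [X /= XD <-].
  by case/imsetP: XD => Y YD ->; exists Y; rewrite //= mult rcf_conj.
exists (conjmx P X); last by rewrite mult rcf_conj.
exact: imset_f.
Qed.

Lemma QuotP Z D :
  reflect (exists X Y, [/\ X \in D, Y \in D, Y \in unitmx & Z = X *m invmx Y])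
          (Z \in Quot D).
Proof.
apply: (iffP imset2P) => [[X Y XD]|[X [Y [XD YD uY ->]]]].
  by rewrite inE => /andP[YD uY] ->; exists X, Y.
by exists X Y; rewrite // inE YD.
Qed.

Lemma Quot_mul P Q D : P \in unitmx -> Q \in unitmx ->
  Quot [set P *m X *m Q | X in D] = [set conjmx P X | X in Quot D].
Proof.
move=> uP uQ.
have quot X Y : Y \in unitmx ->
    (P *m X *m Q) *m invmx (P *m Y *m Q) = conjmx P (X *m invmx Y).
  move=> uY; rewrite conjumx // !invmx_mulmx ?unitmx_mul ?uP //.
  by rewrite !mulmxA mulmxK.
have unit Y : (P *m Y *m Q \in unitmx) = (Y \in unitmx).
  by rewrite !unitmx_mul uP uQ andbT.
apply/setP => Z; apply/QuotP/imsetP => [[_ [_ [/imsetP[X XD ->] /imsetP[Y YD ->]]]]|].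
  rewrite unit => uY ->; exists (X *m invmx Y); last exact: quot.
  by apply/QuotP; exists X, Y.
case=> _ /QuotP[X [Y [XD YD uY ->]]] ->; exists (P *m X *m Q), (P *m Y *m Q).
by rewrite quot // unit uY; split=> //; apply: imset_f.
Qed.

End RationalCanonicalForm.

Section ExtendedAffineEquivalence.

Variables (p n : nat) (F : fieldExtType 'F_p) (p_pr : prime p).

Lemma pchar_fieldExt : p \in [pchar F].
Proof. by rewrite pchar_lalg pchar_Fp. Qed.

Lemma frobeniusD (i : nat) (x y : F) :
  (x + y) ^+ (p ^ i) = x ^+ (p ^ i) + y ^+ (p ^ i).
Proof. by rewrite exprDn_pchar // pnatX pnatE // pchar_fieldExt. Qed.

Lemma additive_scale (f : F -> F) : {morph f : x y / x + y} ->
  forall (c : 'F_p) x, f (c *: x) = c *: f x.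
Proof.
(* A scalar of the prime field is the class of a natural number, so scaling by it is iterated
   addition. *)
move=> fD c x; rewrite -[c]natr_Zp !scaler_nat; elim: (nat_of_ord c) => [|m IH].
  by rewrite !mulr0n morphD0.
by rewrite !mulrS fD IH.
Qed.

Lemma linearizedD (L : {poly F}) : linearized L ->
  {morph horner L : x y / x + y}.
Proof.
case=> m [u ->] x y; rewrite !horner_sum -big_split; apply: eq_bigr => i _ /=.
by rewrite !hornerE frobeniusD mulrDr.
Qed.

Lemma linearized0 (L : {poly F}) : linearized L -> L.[0] = 0.
Proof. by move=> /linearizedD/morphD0. Qed.

(** The direction [a] comes first so that [polar g a] is the map on the field induced by
    [Delta g a]. *)
Definition polar (g : {poly F}) (a x : F) : F := g.[x + a] - g.[x] - g.[a].

Lemma horner_Delta (g : {poly F}) (a x : F) : (Delta g a).[x] = polar g a x.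
Proof. by rewrite /Delta !(horner_comp, hornerE). Qed.

Lemma polar_sum (I : Type) (r : seq I) (P : pred I) (G : I -> {poly F}) a x :
  polar (\sum_(i <- r | P i) G i) a x = \sum_(i <- r | P i) polar (G i) a x.
Proof. by rewrite /polar !horner_sum !sumrB. Qed.

Lemma polar_monomial (c : F) (i j : nat) (a x : F) :
  polar (c *: 'X^(p ^ i + p ^ j)) a x =
    c * (x ^+ (p ^ i) * a ^+ (p ^ j) + a ^+ (p ^ i) * x ^+ (p ^ j)).
Proof.
rewrite /polar !hornerE !exprD !frobeniusD -!mulrBr; congr (c * _).
(* With the Frobenius powers as variables, this is (X + A)(Y + B) - XY - AB = XB + AY. *)
by move: (x ^+ _) (x ^+ _) (a ^+ _) (a ^+ _) => *; ring.
Qed.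

Lemma polarD (g : {poly F}) (a : F) : DO_poly n g ->
  {morph polar g a : x y / x + y}.
Proof.
case=> u -> x y; rewrite !polar_sum -big_split; apply: eq_bigr => i _ /=.
rewrite !polar_sum -big_split; apply: eq_bigr => j _ /=.
rewrite !polar_monomial -mulrDr !frobeniusD; congr (_ * _).
by rewrite mulrDl mulrDr addrACA.
Qed.

Hypothesis dimF : \dim {:F} = n.

(** The field has p^n elements, so ['X^(p ^ n) - 'X] vanishes on all of it; a congruence modulo this
    polynomial thus becomes an equality of values. *)
Lemma horner_modXpn (g : {poly F}) (x : F) :
  (g %% ('X^(p ^ n) - 'X)).[x] = g.[x].
Proof.
rewrite [in RHS](divp_eq g ('X^(p ^ n) - 'X)) !hornerE.
have -> : x ^+ (p ^ n) = x.
  have <- : #|finvect_type F| = (p ^ n)%N.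
    have := card_vspace (fullv : {vspace finvect_type F}).
    by rewrite card_vspacef card_Fp // => ->; rewrite -dimF.
  exact: (@expf_card (finvect_type F)).
by rewrite subrr mulr0 add0r.
Qed.

Variable b : n.-tuple F.
Hypothesis b_basis : basis_of {:F} b.

(** Stated for arbitrary functions, so that polar forms and inverses of bijections get a matrix
    without a polynomial that induces them. *)
Definition fun_matrix (f : F -> F) : 'M['F_p]_n :=
  \matrix_(i < n, j < n) coord b i (f b`_j).

Lemma fun_matrix_comp (f h : F -> F) : {morph f : x y / x + y} ->
  fun_matrix (f \o h) = fun_matrix f *m fun_matrix h.
Proof.
move=> fD; apply/matrixP => i j; rewrite !mxE /= {1}(coord_basis b_basis (memvf (h b`_j))).
rewrite (big_morph f fD (morphD0 fD)) linear_sum; apply: eq_bigr => k _ /=.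
by rewrite additive_scale // linearZ /= !mxE mulrC.
Qed.

(** [fun_matrix_comp] asks additivity of the outer map only, so the set-theoretic inverse of [f]
    directly yields a right inverse matrix. *)
Lemma fun_matrix_unit (f : F -> F) : {morph f : x y / x + y} -> bijective f ->
  fun_matrix f \in unitmx.
Proof.
move=> fD [h _ fK]; have [] // := @mulmx1_unit _ _ (fun_matrix f) (fun_matrix h).
rewrite -fun_matrix_comp //; apply/matrixP => i j.
by rewrite !mxE /= fK coord_free ?(basis_free b_basis) // eq_sym.
Qed.

(* As g' vanishes at 0, its polar form is a second difference: the affine
   summands drop out of it, and so does the translation by u since the polar
   form of g is additive. *)
Lemma polar_EA (g g' L L' L'' : {poly F}) (u v w a x : F) :
  DO_poly n g -> DO_poly n g' ->
  linearized L -> linearized L' -> linearized L'' ->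
  g' %% ('X^(p ^ n) - 'X)
    = (L' \Po (g \Po (L + u%:P)) + v%:P + L'' + w%:P) %% ('X^(p ^ n) - 'X) ->
  polar g' a x = L'.[polar g L.[a] L.[x]].
Proof.
move=> DOg DOg' lL lL' lL'' e.
have g'E y : g'.[y] = L'.[g.[L.[y] + u]] + v + L''.[y] + w.
  by rewrite -horner_modXpn e horner_modXpn !(horner_comp, hornerE).
have g'0 : g'.[0] = 0.
  (* The value [polar g' 0 0] is [- g'.[0]], and additivity at 0 + 0 forces it to vanish. *)
  have := polarD 0 DOg' 0 0; rewrite /polar !addr0 subrr sub0r => /eqP.
  by rewrite eq_sym -subr_eq0 addrK oppr_eq0 => /eqP.
have LB := linearizedD lL'.
have gD y z : g.[y + z] = polar g z y + g.[y] + g.[z].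
  by rewrite /polar; ring.
have -> : polar g' a x = g'.[x + a] - g'.[x] - g'.[a] + g'.[0].
  by rewrite g'0 addr0.
rewrite !g'E (linearizedD lL) (linearizedD lL'') (linearized0 lL) (linearized0 lL'').
(* Every value of [g] at a point shifted by [u] is expanded; the terms [polar g u _] split by
   additivity and cancel in pairs, leaving [polar g L.[a] L.[x]] under [L']. *)
rewrite add0r !(gD _ u) (polarD _ DOg) (gD L.[x]) !LB.
move: L'.[_] L'.[_] L'.[_] L'.[_] L'.[_] L'.[_] L''.[_] L''.[_].
move=> *; ring.
Qed.

Lemma D_set_EA (g g' : {poly F}) : DO_poly n g -> DO_poly n g' ->
  EA_equiv n g g' ->
  exists P Q : 'M['F_p]_n, [/\ P \in unitmx, Q \in unitmx
    & D_set b g' = [set P *m X *m Q | X in D_set b g]].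
Proof.
move=> DOg DOg' [L [L' [L'' [u [v [w [[lL bL] [lL' bL'] lL'' e]]]]]]].
have [LD L'D] := (linearizedD lL, linearizedD lL').
exists (fun_matrix (horner L')), (fun_matrix (horner L)).
have E a : lin_matrix b (Delta g' a) =
    fun_matrix (horner L') *m lin_matrix b (Delta g L.[a]) *m fun_matrix (horner L).
  have -> : lin_matrix b (Delta g L.[a]) = fun_matrix (polar g L.[a]).
    by apply/matrixP => i j; rewrite !mxE horner_Delta.
  rewrite -mulmxA -fun_matrix_comp; last exact: polarD.
  rewrite -fun_matrix_comp //; apply/matrixP => i j.
  by rewrite !mxE horner_Delta (polar_EA a _ DOg DOg' lL lL' lL'' e).
split; [exact: fun_matrix_unit | exact: fun_matrix_unit |].
(* By [E], the matrix of [g'] at [a] comes from that of [g] at [L.[a]]; since [L] is onto, these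
   directions exhaust the field. *)
rewrite -imset_comp; case: bL => Li LK KL.
apply/setP => M; apply/imsetP/imsetP => -[a _ ->].
  by exists (L.[a : F] : finvect_type F); rewrite //= E.
by exists (Li a : finvect_type F); rewrite //= E KL.
Qed.

End ExtendedAffineEquivalence.

Theorem corollary2 (p n : nat) (p_pr : prime p) (p_odd : odd p) (n_gt0 : (0 < n)%N)
    (F : fieldExtType 'F_p) (dimF : \dim {:F} = n)
    (b : n.-tuple F) (b_basis : basis_of {:F} b)
    (g g' : {poly F}) (DO_g : DO_poly n g) (DO_g' : DO_poly n g')
    (g_g' : EA_equiv n g g') :
  rcf_set (Quot (D_set b g)) = rcf_set (Quot (D_set b g')).
Proof.
have [P [Q [uP uQ ->]]] := D_set_EA p_pr dimF b_basis DO_g DO_g' g_g'.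
by rewrite Quot_mul // rcf_set_conj.
Qed.
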